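(* Let $m,n$ be positive integers and let $f:\mathbb H\to\mathbb H$ be sufficiently differentiable (in the real sense, e.g. of class $C^{m+n}$). Define, on $\mathbb H\setminus\mathbb R$, $$\mathcal A_{m,n}(f)=(-1)^{m}e^{|q|^2}\,\overline{\partial}_s^{\,m}\left(\overline q^{\,n}e^{-|q|^2}f\right),\qquad \mathcal B_{m,n}(f)=(-1)^{m+n}e^{|q|^2}\,\overline{\partial}_s^{\,m}\partial_s^{\,n}\left(e^{-|q|^2}f\right).$$ Then, on $\mathbb H\setminus\mathbb R$, $$\mathcal A_{m,n}(f)=m!\,n!\sum_{j=0}^{m}\frac{(-1)^{j}}{j!}\,\frac{H^Q_{m-j,n}(q,\overline q)}{(m-j)!\,n!}\,\overline{\partial}_s^{\,j}(f)$$ and $$\mathcal B_{m,n}(f)=m!\,n!\sum_{j=0}^{m}\sum_{k=0}^{n}\frac{(-1)^{j+k}}{j!\,k!}\,\frac{H^Q_{m-j,n-k}(q,\overline q)}{(m-j)!\,(n-k)!}\,\overline{\partial}_s^{\,j}\partial_s^{\,k}(f).$$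
   Context: $\mathbb H$ is the algebra of real quaternions, $\mathbb S=\{I\in\mathbb H: I^2=-1\}$, $\overline q$ is the quaternionic conjugate and $|q|^2=q\overline q$. Every $q\in\mathbb H\setminus\mathbb R$ is written uniquely as $q=x+yI_q$ with $x\in\mathbb R$, $y>0$, $I_q\in\mathbb S$. For a real differentiable $f$, the left slice derivatives at $q\in\mathbb H\setminus\mathbb R$ are $$\partial_s f(q)=\tfrac12\left(\frac{\partial f_{I_q}}{\partial x}-I_q\frac{\partial f_{I_q}}{\partial y}\right)(q),\qquad \overline{\partial}_s f(q)=\tfrac12\left(\frac{\partial f_{I_q}}{\partial x}+I_q\frac{\partial f_{I_q}}{\partial y}\right)(q),$$ where $f_I$ is the restriction of $f$ to the slice $L_I=\mathbb R+\mathbb R I$, with coordinates $(x,y)\mapsto x+yI$. Superscripts on $\partial_s$, $\overline\partial_s$ denote iterates. For integers $m,n\ge0$, $$H^Q_{m,n}(q,\overline q)=\sum_{k=0}^{\min(m,n)}(-1)^k k!\binom mk\binom nk q^{m-k}\overline q^{\,n-k}.$$ *)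

(* Defs.v *)
From HB Require Import structures.
From mathcomp Require Import all_boot all_order all_algebra.
From mathcomp Require Import ring lra.
From mathcomp Require Import all_classical all_reals all_analysis.

Set Implicit Arguments.
Unset Strict Implicit.
Unset Printing Implicit Defensive.

Import Order.TTheory GRing.Theory Num.Theory.
Import numFieldNormedType.Exports.

Local Open Scope classical_set_scope.
Local Open Scope ring_scope.

(** Quaternions over [R]: [Quat a b c d] is [a + b i + c j + d k]. *)

Record quat (R : Type) := Quat { qre : R ; qi : R ; qj : R ; qk : R }.

Section QuatChoice.
Variable R : Type.

Definition tuple_of_quat (q : quat R) := (qre q, qi q, qj q, qk q).
Definition quat_of_tuple (t : R * R * R * R) :=
  let: (a, b, c, d) := t in Quat a b c d.

Lemma tuple_of_quatK : cancel tuple_of_quat quat_of_tuple.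
Proof. by case. Qed.
End QuatChoice.

HB.instance Definition _ (R : eqType) :=
  Equality.copy (quat R) (can_type (@tuple_of_quatK R)).
HB.instance Definition _ (R : choiceType) :=
  Choice.copy (quat R) (can_type (@tuple_of_quatK R)).

Section QuatAlgebra.
Variable R : realType.
Implicit Types p q r : quat R.

Definition addq p q :=
  Quat (qre p + qre q) (qi p + qi q) (qj p + qj q) (qk p + qk q).
Definition oppq q := Quat (- qre q) (- qi q) (- qj q) (- qk q).

Fact addqA : associative addq.
Proof. by move=> [????] [????] [????]; rewrite /addq /= !addrA. Qed.
Fact addqC : commutative addq.
Proof.
by move=> [a b c d] [a' b' c' d']; congr Quat => /=; rewrite addrC.
Qed.
Fact add0q : left_id (Quat 0 0 0 0) addq.
Proof. by move=> [????]; rewrite /addq /= !add0r. Qed.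
Fact addNq : left_inverse (Quat 0 0 0 0) oppq addq.
Proof. by move=> [????]; rewrite /addq /= !addNr. Qed.
HB.instance Definition _ :=
  GRing.isZmodule.Build (quat R) addqA addqC add0q addNq.

Definition mulq p q :=
  Quat (qre p * qre q - qi p * qi q - qj p * qj q - qk p * qk q)
       (qre p * qi q + qi p * qre q + qj p * qk q - qk p * qj q)
       (qre p * qj q - qi p * qk q + qj p * qre q + qk p * qi q)
       (qre p * qk q + qi p * qj q - qj p * qi q + qk p * qre q).

Fact mulqA : associative mulq.
Proof. by move=> [????] [????] [????]; rewrite /mulq /=; congr Quat; ring. Qed.
Fact mul1q : left_id (Quat 1 0 0 0) mulq.
Proof. by move=> [????]; rewrite /mulq /=; congr Quat; ring. Qed.
Fact mulq1 : right_id (Quat 1 0 0 0) mulq.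
Proof. by move=> [????]; rewrite /mulq /=; congr Quat; ring. Qed.
Fact mulqDl : left_distributive mulq addq.
Proof.
by move=> [????] [????] [????]; rewrite /mulq /addq /=; congr Quat; ring.
Qed.
Fact mulqDr : right_distributive mulq addq.
Proof.
by move=> [????] [????] [????]; rewrite /mulq /addq /=; congr Quat; ring.
Qed.
Fact oneq_neq0 : Quat 1 0 0 0 != 0 :> quat R.
Proof. by apply/eqP => -[] /eqP; rewrite oner_eq0. Qed.
HB.instance Definition _ := GRing.Zmodule_isNzRing.Build (quat R)
  mulqA mul1q mulq1 mulqDl mulqDr oneq_neq0.

Definition scaleq (x : R) q := Quat (x * qre q) (x * qi q) (x * qj q) (x * qk q).

Fact scaleqA x y q : scaleq x (scaleq y q) = scaleq (x * y) q.
Proof. by rewrite /scaleq /= !mulrA. Qed.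
Fact scale1q : left_id 1 scaleq.
Proof. by move=> [????]; rewrite /scaleq /= !mul1r. Qed.
Fact scaleqDr : right_distributive scaleq +%R.
Proof. by move=> x p q; congr Quat => /=; rewrite mulrDr. Qed.
Fact scaleqDl q : {morph scaleq^~ q : x y / x + y}.
Proof. by move=> x y; congr Quat => /=; rewrite mulrDl. Qed.
HB.instance Definition _ := GRing.Zmodule_isLmodule.Build R (quat R)
  scaleqA scale1q scaleqDr scaleqDl.

Fact scaleqAl (x : R) p q : x *: (p * q) = (x *: p) * q.
Proof. by congr Quat => /=; ring. Qed.
HB.instance Definition _ := GRing.Lmodule_isLalgebra.Build R (quat R) scaleqAl.

Fact scaleqAr (x : R) p q : x *: (p * q) = p * (x *: q).
Proof. by congr Quat => /=; ring. Qed.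
HB.instance Definition _ := GRing.Lalgebra_isAlgebra.Build R (quat R) scaleqAr.

Definition conjq q := Quat (qre q) (- qi q) (- qj q) (- qk q).

Definition normq q : R :=
  Num.sqrt (qre q ^+ 2 + qi q ^+ 2 + qj q ^+ 2 + qk q ^+ 2).

Fact sqr_normq q :
  normq q ^+ 2 = qre q ^+ 2 + qi q ^+ 2 + qj q ^+ 2 + qk q ^+ 2.
Proof. by rewrite sqr_sqrtr// !addr_ge0// sqr_ge0. Qed.

Fact ler_normqD p q : normq (p + q) <= normq p + normq q.
Proof.
have n0 r : 0 <= normq r by exact: sqrtr_ge0.
rewrite -ler_sqr ?nnegrE ?addr_ge0// sqrrD !sqr_normq.
pose s := qre p * qre q + qi p * qi q + qj p * qj q + qk p * qk q.
suff : s <= normq p * normq q by rewrite /s /=; lra.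
apply: le_trans (ler_norm _) _.
rewrite -ler_sqr ?nnegrE ?mulr_ge0// real_normK ?num_real// exprMn !sqr_normq.
rewrite -subr_ge0 [leRHS](_ : _ =
    (qre p * qi q - qi p * qre q) ^+ 2 + (qre p * qj q - qj p * qre q) ^+ 2 +
    (qre p * qk q - qk p * qre q) ^+ 2 + (qi p * qj q - qj p * qi q) ^+ 2 +
    (qi p * qk q - qk p * qi q) ^+ 2 + (qj p * qk q - qk p * qj q) ^+ 2).
  by rewrite !addr_ge0// sqr_ge0.
by rewrite /s; ring.
Qed.

Fact normqZ (x : R) q : normq (x *: q) = `|x| * normq q.
Proof.
rewrite /normq /= -sqrtr_sqr -sqrtrM ?sqr_ge0//.
by congr Num.sqrt; ring.
Qed.

Fact normq_eq0 q : normq q = 0 -> q = 0.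
Proof.
move=> /(congr1 (fun x => x ^+ 2)); rewrite sqr_normq expr0n /=.
move=> /eqP; rewrite !paddr_eq0 ?addr_ge0 ?sqr_ge0// !sqrf_eq0.
by case: q => a b c d /= /andP[/andP[/andP[/eqP-> /eqP->] /eqP->] /eqP->].
Qed.

HB.instance Definition _ :=
  Lmodule_isNormed.Build R (quat R) ler_normqD normqZ normq_eq0.

Lemma normq_conj q : (`|q| ^+ 2)%:A = q * conjq q.
Proof. by rewrite [_ ^+ 2]sqr_normq; congr Quat => /=; ring. Qed.

End QuatAlgebra.

Section Slices.
Variable R : realType.
Implicit Types (p q I : quat R) (f : quat R -> quat R).

Definition realq : set (quat R) := range (fun x : R => x%:A).

Definition unit_sphere : set (quat R) := [set I | I ^+ 2 = -1].

(** The [x], [y], [I_q] of [q = x + y I_q]; meaningful for non-real [q],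
    see [slice_decomposition]. *)
Definition imq q := Quat 0 (qi q) (qj q) (qk q).
Definition slice_x q : R := qre q.
Definition slice_y q : R := `|imq q|.
Definition slice_I q : quat R := `|imq q|^-1 *: imq q.

Lemma slice_decomposition q : ~ realq q -> forall x y I,
  [/\ 0 < y, unit_sphere I & q = x%:A + y *: I] <->
  [/\ x = slice_x q, y = slice_y q & I = slice_I q].
Proof.
move=> qR x y I.
have im0 : 0 < `|imq q|.
  rewrite normr_gt0; apply/eqP => -[b0 c0 d0]; apply: qR; exists (qre q) => //.
  by case: q b0 c0 d0 => a b c d /= -> -> ->; congr Quat => /=; ring.
have imE : `|imq q| ^+ 2 = qi q ^+ 2 + qj q ^+ 2 + qk q ^+ 2.
  by rewrite [LHS]sqr_normq /=; ring.
split=> [[y0 IS qE]|[-> -> ->]]; last first.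
  split; first exact: im0.
    rewrite /unit_sphere /= /slice_I expr2 -scalerAl -scalerAr scalerA.
    have -> : imq q * imq q = - (`|imq q| ^+ 2)%:A.
      by rewrite imE; congr Quat => /=; ring.
    rewrite scalerN scalerA -expr2 -exprMn mulVf ?gt_eqF// expr1n.
    by rewrite scale1r.
  rewrite /slice_y /slice_I scalerA mulfV ?gt_eqF// scale1r /slice_x.
  by case: q {qR im0 imE} => a b c d; congr Quat => /=; ring.
have [I0 In] : qre I = 0 /\ qi I ^+ 2 + qj I ^+ 2 + qk I ^+ 2 = 1.
  case: I IS {qE} => a b c d; rewrite /unit_sphere expr2 => -[/=].
  move=> e1 e2 e3 e4.
  have /eqP : a = 0.
    have [//|a0] := eqVneq a 0.
    have Z z : a * z + z * a = 0 -> z = 0.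
      move=> /eqP; rewrite [z * a]mulrC -mulr2n mulrn_eq0 /= mulf_eq0.
      by rewrite (negPf a0) => /eqP.
    have b0 : b = 0 by apply: Z; lra.
    have c0 : c = 0 by apply: Z; lra.
    have d0 : d = 0 by apply: Z; lra.
    by rewrite b0 c0 d0 in e1; have := sqr_ge0 a; rewrite expr2; lra.
  by move=> /eqP a0; split => //; rewrite a0 in e1; rewrite !expr2; lra.
have qimE : imq q = y *: I.
  by rewrite qE; case: I I0 {IS In qE} => a b c d /= ->; congr Quat => /=; ring.
have yE : slice_y q = y.
  rewrite /slice_y qimE normrZ gtr0_norm// [`|I|](_ : _ = 1) ?mulr1//.
  by rewrite [LHS]/(normq I) /normq I0 -[RHS]sqrtr1; congr Num.sqrt; rewrite -In; ring.
split => //.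
  by rewrite qE /slice_x /= I0; ring.
by rewrite /slice_I -/(slice_y q) yE qimE scalerA mulVf ?gt_eqF// scale1r.
Qed.

(** [f_I], the restriction of [f] to the slice [L_I], in the coordinates
    [(x, y)]. *)
Definition on_slice f I (x y : R) : quat R := f (x%:A + y *: I).

Definition slice_dx f q : quat R :=
  derive1 (on_slice f (slice_I q) ^~ (slice_y q)) (slice_x q).
Definition slice_dy f q : quat R :=
  derive1 (on_slice f (slice_I q) (slice_x q)) (slice_y q).

(** Total functions; they carry the left slice derivatives off the real axis.
    Since the set of non-real quaternions is open, the values on the real axis
    do not affect the iterates at non-real points. *)
Definition ds f q : quat R :=
  2^-1 *: (slice_dx f q - slice_I q * slice_dy f q).
Definition dsbar f q : quat R :=
  2^-1 *: (slice_dx f q + slice_I q * slice_dy f q).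

Definition HQ (m n : nat) q : quat R :=
  \sum_(k < (minn m n).+1)
    ((-1) ^+ k * (k`! * 'C(m, k) * 'C(n, k))%:R) *:
      (q ^+ (m - k) * conjq q ^+ (n - k)).

Definition opA (m n : nat) f q : quat R :=
  ((-1) ^+ m * expR (`|q| ^+ 2)) *:
    iter m dsbar (fun p => conjq p ^+ n * (expR (- `|p| ^+ 2) *: f p)) q.

Definition opB (m n : nat) f q : quat R :=
  ((-1) ^+ (m + n) * expR (`|q| ^+ 2)) *:
    iter m dsbar (iter n ds (fun p => expR (- `|p| ^+ 2) *: f p)) q.

End Slices.

(** Class [C^k]: all iterated directional derivatives of order at most [k]
    exist everywhere and are continuous. *)
Fixpoint classC (R : realType) (V W : normedModType R) (k : nat) (f : V -> W)
    : Prop :=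
  continuous f /\
  (if k is k'.+1 then
     forall v : V, (forall x, derivable f x v) /\ classC k' ('D_v f)
   else True).

(* Main.v *)
Require Import Defs.
From mathcomp Require Import all_boot all_order all_algebra.
From mathcomp Require Import all_classical all_reals all_analysis.
From mathcomp Require Import ring lra.
Set Implicit Arguments.
Unset Strict Implicit.
Unset Printing Implicit Defensive.
Import Order.TTheory GRing.Theory Num.Theory.
Import numFieldNormedType.Exports.
Local Open Scope classical_set_scope.
Local Open Scope ring_scope.

(** Near a non-real point, the slice derivatives only see the open half plane
    through that point, [half_slice I], and there they are the constant
    coefficient operators [(d/dx + e I d/dy) / 2] with [e = 1] for [dsbar] and
    [e = -1] for [ds]. So [I] is fixed and all identities are proved on its
    half plane.

    Quaternions do not commute, but a weight whose values commute with [I]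
    can be moved across the factor [I] of the operator, so such an operator
    [D] obeys [D (w * u) = D w * u + w * D u] ([is_sderiveM]). If moreover a
    sequence of such weights satisfies [D (w i) = w i.+1], then the binomial
    Leibniz formula
    [D^m (w 0 * g) = \sum_j 'C(m, j) w (m - j) * D^j g]
    follows by induction on [m] ([iter_cr_leibniz]). Two sequences of weights
    are used, both polynomials in [q] and [conjq q] times the Gaussian:
    - for [dsbar], [(-1)^i H_{i,n} exp(- |q|^2)] ([is_sderive_rodrigues]): by
      the recurrence [dsbar H_{i,n} = q H_{i,n} - H_{i+1,n}] ([HQ_rec]) and
      [dsbar exp(- |q|^2) = - q exp(- |q|^2)], each one is the derivative of
      the one before; the first is [conjq q ^ n exp(- |q|^2)] because
      [H_{0,n} = conjq q ^ n]. This is the formula for [opA], up to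
      rewriting the binomial coefficients.
    - for [ds], [(-1)^i (conjq q)^i exp(- |q|^2)] ([is_sderive_conj_weight]),
      since [ds] kills [conjq].
    In [opB], the second sequence expands the inner [n] derivatives as a
    combination of terms [(conjq q)^(n - k) exp(- |q|^2) ds^k f], and
    the first one then applies to each term. To avoid splitting iterated
    derivatives of a sum of functions, the Leibniz formula is stated for a
    finite sum of products.

    The regularity needed along the way is transferred from [f]: on a
    half plane the iterated slice derivatives of [f] agree with those of the
    globally defined constant coefficient operators [cst_cr], which lower the
    class by one ([slice_classC_iter]). *)

(** * Directional derivatives *)

Section Line.
Context {R : realType} {V W : normedModType R}.
Implicit Types (f g : V -> W) (a v : V) (d : W).

Lemma is_derive_cvgP f a v d : is_derive a v f d <->
  (fun h : R => h^-1 *: (f (h *: v + a) - f a)) @ 0^' --> d.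
Proof.
split=> [[df <-]|fd]; first exact: df.
by split; [apply/cvg_ex; exists d | apply/cvg_lim].
Qed.

(** A derivative along [v] only depends on values on the line through [a]; this
    is what makes it usable for functions that agree on one slice, a set with
    empty interior. *)
Lemma eq_on_line_is_derive f g a v d :
  (\forall h \near (0 : R), f (h *: v + a) = g (h *: v + a)) ->
  is_derive a v f d -> is_derive a v g d.
Proof.
move=> fg /is_derive_cvgP fd; apply/is_derive_cvgP; apply: cvg_trans fd.
have fga : f a = g a by move: (nbhs_singleton fg); rewrite /= scale0r add0r.
apply: near_eq_cvg; apply: cvg_within; apply: filterS fg => h /= ->.
by rewrite fga.
Qed.

Lemma is_derive_cvg_line f a v d : is_derive a v f d ->
  (fun h : R => f (h *: v + a)) @ 0^' --> f a.
Proof.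
case=> /derivable1P/derivable1_diffP/differentiable_continuous + _.
by move=> /continuous_withinNx; rewrite scale0r add0r.
Qed.

End Line.

(** * Calculus of quaternion-valued functions *)

Section QuatCalculus.
Variable R : realType.
Implicit Types (p q : quat R) (x y e : R).

Lemma normqE p : (`|p| : R) = Defs.normq p. Proof. by []. Qed.

(** The norm is multiplicative by Euler's four-square identity; it serves to
    show that the product is continuous. *)
Lemma normqM p q : `|p * q| = `|p| * `|q|.
Proof.
rewrite !normqE /Defs.normq -sqrtrM ?addr_ge0 ?sqr_ge0//.
by congr Num.sqrt; rewrite /=; ring.
Qed.

Lemma cvg_mulq {T : Type} {F : set_system T} {FF : Filter F}
    (u w : T -> quat R) p q :
  u @ F --> p -> w @ F --> q -> (fun h => u h * w h) @ F --> p * q.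
Proof.
move=> up wq; apply/subr_cvg0.
have -> : (fun h => u h * w h - p * q) =
    (fun h => (u h - p) * w h) + (fun h => p * (w h - q)).
  by apply/funext => h; rewrite fctE mulrBl mulrBr addrA subrK.
rewrite -[0]addr0; apply: cvgD.
  apply/norm_cvg0P; under eq_fun do rewrite normqM.
  rewrite -(mul0r `|q|); apply: cvgM; last exact: cvg_norm.
  by apply/norm_cvg0P/subr_cvg0.
apply/norm_cvg0P; under eq_fun do rewrite normqM.
rewrite -(mulr0 `|p|); apply: cvgM; first exact: cvg_cst.
by apply/norm_cvg0P/subr_cvg0.
Qed.

Lemma is_derive_mulq {V : normedModType R} (u w : V -> quat R) (a v : V) du dw :
  is_derive a v u du -> is_derive a v w dw ->
  is_derive a v (fun z => u z * w z) (du * w a + u a * dw).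
Proof.
move=> ud wd; have wc := is_derive_cvg_line wd.
move: ud wd => /is_derive_cvgP ud /is_derive_cvgP wd; apply/is_derive_cvgP.
have -> : (fun h : R => h^-1 *:
      (u (h *: v + a) * w (h *: v + a) - u a * w a)) =
    (fun h : R => h^-1 *: (u (h *: v + a) - u a) * w (h *: v + a)) +
    (fun h : R => u a * (h^-1 *: (w (h *: v + a) - w a))).
  apply/funext => h; rewrite fctE -scalerAl -scalerAr -scalerDr.
  by rewrite mulrBl mulrBr addrA subrK.
by apply: cvgD; apply: cvg_mulq => //; exact: cvg_cst.
Qed.

Lemma is_derive_algC {V : normedModType R} (c : V -> R) (a v : V) dc :
  is_derive a v c dc -> is_derive a v (fun z => (c z)%:A : quat R) dc%:A.
Proof.
move=> /is_derive_cvgP cd; apply/is_derive_cvgP.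
under eq_fun do rewrite -scalerBl scalerA.
exact: cvgZr_tmp.
Qed.

Lemma conjqZD x p q : conjq (x *: p + q) = x *: conjq p + conjq q.
Proof. by congr Quat; rewrite /=; ring. Qed.

Lemma is_derive_conjq p v : is_derive p v (@conjq R) (conjq v).
Proof.
apply/is_derive_cvgP; apply: cvg_near_cst.
apply: filterS (nbhs_dnbhs_neq 0) => h h0.
by rewrite conjqZD addrK scalerA mulVf ?scale1r.
Qed.

Definition dotq p q :=
  qre p * qre q + qi p * qi q + qj p * qj q + qk p * qk q.

(** Along a line, [- |p + h v|^2] is a quadratic polynomial in [h] with linear
    coefficient [- 2 <p, v>]. *)
Lemma is_derive_gauss p v :
  is_derive p v (fun z => expR (- `|z| ^+ 2))
    (- 2 * dotq p v * expR (- `|p| ^+ 2)).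
Proof.
pose P (h : R) := - `|p| ^+ 2 + (- 2 * dotq p v) * h + (- `|v| ^+ 2) * (h * h).
have PE h : expR (- `|h *: v + p| ^+ 2) = expR (P h).
  by congr expR; rewrite /P !normqE !sqr_normq /dotq /=; ring.
have dP : is_derive (0 : R) 1 P (- 2 * dotq p v).
  rewrite /P; apply: is_derive_eq; rewrite /GRing.scale/=; ring.
have /is_derive_cvgP := is_derive1_comp (is_derive_expR (P 0)) dP.
have P0 : P 0 = - `|p| ^+ 2 by rewrite /P; ring.
rewrite P0 mulrC => H; apply/is_derive_cvgP; move: H; apply: cvg_trans.
apply: near_eq_cvg; apply: nearW => h.
by rewrite PE /= addr0 P0 [h *: 1]mulr1.
Qed.

End QuatCalculus.

(** * Functions of class C^k *)

Section ClassC.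
Context {R : realType}.
Implicit Types (f g : quat R -> quat R) (p q : quat R).

Lemma classCW k f : classC k.+1 f -> classC k f.
Proof.
elim: k f => [|k IH] f [cf df]; split=> // v.
by have [fv Cf] := df v; split; [exact: fv | exact: IH].
Qed.

Lemma classCD k f g : classC k f -> classC k g -> classC k (fun q => f q + g q).
Proof.
elim: k f g => [|k IH] f g [cf df] [cg dg]; split=> //.
- by move=> q; exact: cvgD (cf q) (cg q).
- by move=> q; exact: cvgD (cf q) (cg q).
move=> v; have [fv Cf] := df v; have [gv Cg] := dg v; split.
  by move=> q; exact: derivableD.
rewrite (_ : 'D_v _ = fun q => 'D_v f q + 'D_v g q); first exact: IH.
by apply/funext => q; exact: deriveD.
Qed.

Lemma is_derive_mull {V : normedModType R} p (f : V -> quat R) a v d :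
  is_derive a v f d -> is_derive a v (fun z => p * f z) (p * d).
Proof.
move=> fd; apply: is_derive_eq (is_derive_mulq (is_derive_cst p a v) fd) _.
by rewrite mul0r add0r.
Qed.

Lemma classC_mull k p f : classC k f -> classC k (fun q => p * f q).
Proof.
have C g : continuous g -> continuous (fun q => p * g q).
  by move=> cg q; exact: cvg_mulq (cvg_cst p) (cg q).
elim: k f => [|k IH] f [cf df]; split=> //; try exact: C.
move=> v; have [fv Cf] := df v.
have D q : is_derive q v (fun z => p * f z) (p * 'D_v f q).
  by apply: is_derive_mull; split.
split=> [q|]; first by case: (D q).
rewrite (_ : 'D_v _ = fun q => p * 'D_v f q); first exact: IH.
by apply/funext => q; case: (D q).
Qed.

(** Freezing the unit [I] of a slice derivative makes it an operator with
    constant coefficients, which has a meaning on the real axis too and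
    lowers the class by just one. *)
Definition cst_cr (e : R) (I : quat R) f q : quat R :=
  2^-1 *: ('D_1 f q + e *: (I * 'D_I f q)).

Lemma classC_cst_cr k e I f : classC k.+1 f -> classC k (cst_cr e I f).
Proof.
move=> [_ df].
rewrite (_ : cst_cr e I f =
    fun q => (2^-1)%:A * 'D_1 f q + ((2^-1 * e) *: I) * 'D_I f q); last first.
  by apply/funext => q; rewrite /cst_cr scalerDr scalerA -!scalerAl mul1r.
by apply: classCD; apply: classC_mull; [case: (df 1) | case: (df I)].
Qed.

End ClassC.

(** * Half slices and slice derivatives *)

Section Slice.
Context {R : realType}.
Implicit Types (f g u w : quat R -> quat R) (p q I : quat R) (x y e : R).

(** A single Cauchy-Riemann operator for both slice derivatives: [dsbar] is
    the case [e = 1] and [ds] the case [e = -1]. *)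
Definition cr e f q : quat R :=
  2^-1 *: (slice_dx f q + e *: (slice_I q * slice_dy f q)).

Lemma dsbarE : @dsbar R = cr 1.
Proof. by apply/funext => f; apply/funext => q; rewrite /cr scale1r. Qed.

Lemma dsE : @ds R = cr (-1).
Proof. by apply/funext => f; apply/funext => q; rewrite /cr scaleN1r. Qed.

(** For an imaginary unit [I], the open half plane of the [x + y I] with
    [0 < y]. *)
Definition half_slice I : set (quat R) := [set q | ~ realq q /\ slice_I q = I].

Lemma sqr_slice_I q : ~ realq q -> slice_I q * slice_I q = -1.
Proof.
move=> qR; rewrite -expr2.
by have [] := (slice_decomposition qR _ _ _).2 (And3 erefl erefl erefl).
Qed.

Lemma sliceE q : ~ realq q ->
  0 < slice_y q /\ q = (slice_x q)%:A + slice_y q *: slice_I q.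
Proof.
move=> qR.
by have [] := (slice_decomposition qR _ _ _).2 (And3 erefl erefl erefl).
Qed.

Lemma half_slice_intro I x y : I * I = -1 -> 0 < y ->
  half_slice I (x%:A + y *: I).
Proof.
move=> I2 y0.
have qR : ~ realq (x%:A + y *: I).
  (* otherwise [I] would be real and its square could not be -1 *)
  case=> z _ zE; have IE : I = ((z - x) / y)%:A.
    rewrite mulrC -scalerA scalerBl zE addrAC subrr add0r scalerA.
    by rewrite mulVf ?scale1r ?gt_eqF.
  move: I2; rewrite IE -scalerAl mul1r scalerA => /(congr1 (@qre R)) /=.
  rewrite mulr1 => /eqP; rewrite -subr_eq0 opprK => /eqP E.
  by have := sqr_ge0 ((z - x) / y); rewrite expr2; lra.
split=> //.
have [] := (slice_decomposition qR x y I).1; last by [].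
by split=> //; rewrite /unit_sphere /= expr2.
Qed.

(** Horizontal moves keep [y], hence the half plane; vertical ones
    ([half_slice_y]) only do so while [y] stays positive. *)
Lemma half_slice_x I q : half_slice I q ->
  \forall h \near (0 : R), half_slice I (h *: 1 + q).
Proof.
move=> [qR qI]; have [y0 qE] := sliceE qR; have I2 := sqr_slice_I qR.
apply: (filterS _ (filterT : nbhs (0 : R) setT)) => h _.
rewrite qE qI addrA -scalerDl.
by apply: half_slice_intro => //; rewrite -qI.
Qed.

Lemma half_slice_y I q : half_slice I q ->
  \forall h \near (0 : R), half_slice I (h *: I + q).
Proof.
move=> [qR qI]; have [y0 qE] := sliceE qR; have I2 := sqr_slice_I qR.
have : \forall h \near (0 : R), - slice_y q < h.
  by apply: lt_nbhsr; rewrite oppr_lt0.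
apply: filterS => h hy; rewrite qE qI addrCA -scalerDl.
by apply: half_slice_intro; [rewrite -qI | rewrite -ltrBlDr sub0r].
Qed.

(** A relation rather than a value, because [cr] is total and its value says
    nothing where a partial derivative is missing. *)
Definition is_sderive e q w d := exists a b,
  [/\ is_derive q 1 w a, is_derive q (slice_I q) w b &
      d = 2^-1 *: (a + e *: (slice_I q * b))].

Lemma slice_dxE f q : ~ realq q -> slice_dx f q = 'D_1 f q.
Proof.
move=> qR; have [_ qE] := sliceE qR; rewrite /slice_dx /derive1 /derive.
apply: (congr1 (fun F : R -> quat R => lim (F @ 0^'))); apply/funext => h /=.
by rewrite /on_slice scalerDl -addrA -qE.
Qed.

Lemma slice_dyE f q : ~ realq q -> slice_dy f q = 'D_(slice_I q) f q.
Proof.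
move=> qR; have [_ qE] := sliceE qR; rewrite /slice_dy /derive1 /derive.
apply: (congr1 (fun F : R -> quat R => lim (F @ 0^'))); apply/funext => h /=.
by rewrite /on_slice scalerDl addrCA -qE.
Qed.

Lemma cr_cst_cr e f q : ~ realq q -> cr e f q = cst_cr e (slice_I q) f q.
Proof. by move=> qR; rewrite /cr slice_dxE // slice_dyE. Qed.

Lemma is_sderive_cr e f q d : ~ realq q -> is_sderive e q f d -> cr e f q = d.
Proof.
move=> qR [a [b [[_ da] [_ db] ->]]].
by rewrite cr_cst_cr // /cst_cr da db.
Qed.

(** The lines along [1] and along [I] stay in the half slice near [q]. *)
Lemma is_sderive_local e I q f g d : half_slice I q ->
  {in half_slice I, f =1 g} -> is_sderive e q f d -> is_sderive e q g d.
Proof.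
move=> qI fg [a [b [da db ->]]]; exists a, b; split=> //.
  apply: eq_on_line_is_derive da.
  by apply: filterS (half_slice_x qI) => h hI; rewrite fg ?inE.
rewrite (proj2 qI) in db *.
apply: eq_on_line_is_derive db.
by apply: filterS (half_slice_y qI) => h hI; rewrite fg ?inE.
Qed.

Lemma is_sderive_sum e q n (f : 'I_n -> quat R -> quat R) d :
  (forall i, is_sderive e q (f i) (d i)) ->
  is_sderive e q (fun z => \sum_(i < n) f i z) (\sum_(i < n) d i).
Proof.
have sumE : \sum_(i < n) f i = (fun z => \sum_(i < n) f i z).
  by apply/funext => z; rewrite fct_sumE.
move=> /choice[a] /choice[b] fd; exists (\sum_i a i), (\sum_i b i); split.
- by rewrite -sumE; apply: is_derive_sum => i; case: (fd i).
- by rewrite -sumE; apply: is_derive_sum => i; case: (fd i).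
rewrite mulr_sumr scaler_sumr -big_split scaler_sumr; apply: eq_bigr => i _.
by case: (fd i).
Qed.

(** The product rule holds without commutativity because [I (w u') = w (I u')]
    when [w q] commutes with [I]. *)
Lemma is_sderiveM e q w u dw du : GRing.comm (w q) (slice_I q) ->
  is_sderive e q w dw -> is_sderive e q u du ->
  is_sderive e q (fun z => w z * u z) (dw * u q + w q * du).
Proof.
move=> wI [a [b [wa wb ->]]] [a' [b' [ua ub ->]]].
exists (a * u q + w q * a'), (b * u q + w q * b').
split; [exact: is_derive_mulq | exact: is_derive_mulq | ].
rewrite -scalerAl -scalerAr -scalerDr; congr (_ *: _).
rewrite mulrDl mulrDr addrACA; congr (_ + _).
rewrite -scalerAl -scalerAr -scalerDr; congr (_ *: _).
by rewrite mulrDr !mulrA wI.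
Qed.

Lemma is_sderive_cst e q p : is_sderive e q (fun=> p) 0.
Proof.
exists 0, 0; split; [exact: is_derive_cst | exact: is_derive_cst |].
by rewrite mulr0 scaler0 addr0 scaler0.
Qed.

Lemma is_sderiveZ e q (c : R) w d :
  is_sderive e q w d -> is_sderive e q (fun z => c *: w z) (c *: d).
Proof.
move=> [a [b [da db ->]]]; exists (c *: a), (c *: b).
split; [exact: is_deriveZ | exact: is_deriveZ |].
rewrite -scalerAr [e *: (c *: _)]scalerA [e * c]mulrC -scalerA -scalerDr.
by rewrite !scalerA mulrC.
Qed.

Lemma is_sderiveMn e q n w d :
  is_sderive e q w d -> is_sderive e q (fun z => w z *+ n) (d *+ n).
Proof.
move=> /(is_sderiveZ n%:R); rewrite scaler_nat.
by under eq_fun do rewrite scaler_nat.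
Qed.

End Slice.

(** * Regularity of iterated slice derivatives *)

Section Regularity.
Context {R : realType}.
Implicit Types (u v : quat R -> quat R) (q I : quat R) (e : R).

(** Slice derivatives of a smooth function need not extend continuously to
    the real axis; what survives iteration is to agree on a half slice with a
    function of class [classC]. *)
Definition slice_classC I k u :=
  exists2 v, classC k v & {in half_slice I, u =1 v}.

Lemma slice_classC_addl k j I u :
  slice_classC I (j + k) u -> slice_classC I k u.
Proof.
by case=> v; elim: j => [|j IH] Cv uv; [exists v | apply: IH (classCW Cv) uv].
Qed.

Lemma classC_is_sderive k e q v : classC k.+1 v ->
  is_sderive e q v (cst_cr e (slice_I q) v q).
Proof.
move=> [_ dv]; exists ('D_1 v q), ('D_(slice_I q) v q).
by split; [split; first case: (dv 1) | split; first case: (dv (slice_I q)) |].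
Qed.

Lemma slice_classC_sderive k e I q u : slice_classC I k.+1 u ->
  half_slice I q -> is_sderive e q u (cr e u q).
Proof.
move=> [v Cv uv] qI.
have H : is_sderive e q u (cst_cr e (slice_I q) v q).
  apply: is_sderive_local qI _ (classC_is_sderive _ _ Cv) => z zI.
  by rewrite uv.
by rewrite (is_sderive_cr (proj1 qI) H).
Qed.

Lemma slice_classC_cr k e I u :
  slice_classC I k.+1 u -> slice_classC I k (cr e u).
Proof.
move=> [v Cv uv]; exists (cst_cr e I v); first exact: classC_cst_cr.
move=> q; rewrite inE => qI; apply: (is_sderive_cr (proj1 qI)).
rewrite -{1}(proj2 qI).
by apply: is_sderive_local qI _ (classC_is_sderive _ _ Cv) => z zI; rewrite uv.
Qed.

Lemma slice_classC_iter j k e I u :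
  slice_classC I (j + k) u -> slice_classC I k (iter j (cr e) u).
Proof.
elim: j k => [//|j IH] k; rewrite addSnnS => /IH; exact: slice_classC_cr.
Qed.

End Regularity.

(** * Leibniz formula *)

Section Leibniz.

(** With [a i j] in the role of [D^i w * D^j g], Pascal's rule turns the
    derivative of the Leibniz expansion of order [m] into the one of order
    [m.+1]. *)
Lemma pascal_sum (V : nmodType) (a : nat -> nat -> V) m :
  \sum_(j < m.+1) (a (m - j).+1 j + a (m - j)%N j.+1) *+ 'C(m, j) =
  \sum_(j < m.+2) a (m.+1 - j)%N j *+ 'C(m.+1, j).
Proof.
under eq_bigr do rewrite mulrnDl.
rewrite big_split /= [RHS]big_ord_recl.
have -> : \sum_(j < m.+1) a (m.+1 - lift ord0 j)%N (lift ord0 j) *+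
      'C(m.+1, lift ord0 j) =
    \sum_(j < m.+1) a (m - j)%N j.+1 *+ 'C(m, j.+1) +
    \sum_(j < m.+1) a (m - j)%N j.+1 *+ 'C(m, j).
  rewrite -big_split; apply: eq_bigr => j _.
  by rewrite lift0 binS mulrnDr subSS.
rewrite addrA; congr (_ + _).
transitivity (\sum_(j < m.+2) a (m.+1 - j)%N j *+ 'C(m, j)); last first.
  by rewrite [LHS]big_ord_recl !bin0; congr (_ + _).
rewrite [RHS]big_ord_recr /= bin_small // mulr0n addr0.
by apply: eq_bigr => i _; rewrite subSn // -ltnS.
Qed.

Context {R : realType}.
Implicit Types (u : quat R -> quat R) (q I : quat R) (e : R).

(** Each application of the operator moves one index up, either in [w] or in
    the number of derivatives of [g], and Pascal's rule collects the terms. *)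
Lemma iter_cr_leibniz e I m N (w : 'I_N -> nat -> quat R -> quat R)
    (g : 'I_N -> quat R -> quat R) u :
  (forall k i q, half_slice I q -> GRing.comm (w k i q) I) ->
  (forall k i q, half_slice I q -> is_sderive e q (w k i) (w k i.+1 q)) ->
  (forall k, slice_classC I m (g k)) ->
  {in half_slice I, forall q, u q = \sum_(k < N) w k 0%N q * g k q} ->
  {in half_slice I, forall q, iter m (cr e) u q =
    \sum_(k < N) \sum_(j < m.+1)
       (w k (m - j)%N q * iter j (cr e) (g k) q) *+ 'C(m, j)}.
Proof.
move=> wI dw.
elim: m => [|m IH] Cg ug q.
  move=> /ug /= ->; apply: eq_bigr => k _.
  by rewrite big_ord1 mulr1n.
rewrite inE => qI; have [qR qIE] := qI; apply: (is_sderive_cr qR).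
have IHm := IH (fun k => @slice_classC_addl _ m 1 _ _ (Cg k)) ug.
apply: (is_sderive_local qI (fun z zI => esym (IHm z zI))).
apply: is_sderive_sum => k.
rewrite -(pascal_sum (fun i j => w k i q * iter j (cr e) (g k) q)).
apply: is_sderive_sum => j.
apply: is_sderiveMn; apply: is_sderiveM.
- by rewrite qIE; exact: wI.
- exact: dw.
apply: (@slice_classC_sderive _ (m - j)) qI.
by apply: slice_classC_iter; rewrite addnS subnKC // -ltnS.
Qed.

End Leibniz.

(** * Slice derivatives of the coordinate, its conjugate and the Gaussian *)

Section Weights.
Context {R : realType}.
Implicit Types (q I p : quat R) (e d : R).

Lemma conjqE q : conjq q = (2 * qre q)%:A - q.
Proof. by congr Quat; rewrite /=; ring. Qed.

Lemma comm_algC p (c : R) : GRing.comm p c%:A.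
Proof. by rewrite /GRing.comm -scalerAl -scalerAr mulr1 mul1r. Qed.

Lemma comm_conjq p q : GRing.comm p q -> GRing.comm p (conjq q).
Proof. by move=> pq; rewrite conjqE; apply: commrB => //; exact: comm_algC. Qed.

Lemma comm_HQ p q m n : GRing.comm p q -> GRing.comm p (HQ m n q).
Proof.
move=> pq; apply: commr_sum => k _; rewrite /GRing.comm -scalerAl -scalerAr.
by congr (_ *: _); apply: commrM; apply: commrX => //; exact: comm_conjq.
Qed.

Lemma comm_slice_I I q : half_slice I q -> GRing.comm I q.
Proof.
move=> [qR <-]; have [_ {2}->] := sliceE qR.
apply: commrD; first exact: comm_algC.
by rewrite /GRing.comm -scalerAr scalerAl.
Qed.

Lemma is_sderive_id e q : ~ realq q ->
  is_sderive e q (fun z => z) (2^-1 * (1 - e))%:A.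
Proof.
move=> qR; exists 1, (slice_I q); split; try exact: is_derive_id.
by rewrite sqr_slice_I // scalerN -scalerA scalerBl scale1r.
Qed.

Lemma conj_slice_I q : conjq (slice_I q) = - slice_I q.
Proof. by congr Quat; rewrite /= ?mulr0 ?oppr0. Qed.

Lemma is_sderive_conjq e q : ~ realq q ->
  is_sderive e q (@conjq R) (2^-1 * (1 + e))%:A.
Proof.
move=> qR; exists (conjq 1), (conjq (slice_I q)).
split; try exact: is_derive_conjq.
rewrite conj_slice_I mulrN sqr_slice_I // opprK -scalerA scalerDl scale1r.
by congr (_ *: (_ + _)); congr Quat; rewrite /= ?oppr0.
Qed.

(** The usual power rule, since a real derivative commutes with [w q]. The case
    [d = 0] covers the powers of a function that the operator kills. *)
Lemma is_sderiveX e q (w : quat R -> quat R) d n :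
  GRing.comm (w q) (slice_I q) -> is_sderive e q w d%:A ->
  is_sderive e q (fun z => w z ^+ n) ((n%:R * d) *: w q ^+ n.-1).
Proof.
move=> wI wd; elim: n => [|n IH].
  by rewrite mul0r scale0r; exact: is_sderive_cst.
under eq_fun do rewrite exprS.
have -> : (n.+1%:R * d) *: w q ^+ n.+1.-1 =
    d%:A * w q ^+ n + w q * ((n%:R * d) *: w q ^+ n.-1).
  rewrite -scalerAl mul1r -scalerAr [n.+1.-1]/=.
  case: n {IH} => [|n]; first by rewrite !mul0r scale0r addr0 mul1r.
  by rewrite /= -exprS -scalerDl -[n.+2]add1n natrD mulrDl mul1r.
exact: is_sderiveM.
Qed.

Definition gauss q : quat R := (expR (- `|q| ^+ 2))%:A.

Lemma dotq_slice_I q : dotq q (slice_I q) = slice_y q.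
Proof.
have E : slice_y q ^+ 2 = qi q ^+ 2 + qj q ^+ 2 + qk q ^+ 2.
  by rewrite [LHS]sqr_normq /=; ring.
transitivity ((slice_y q)^-1 * slice_y q ^+ 2).
  by rewrite E /dotq /slice_I /slice_y /=; ring.
have [->|y0] := eqVneq (slice_y q) 0; first by rewrite expr0n mulr0.
by rewrite expr2 mulKf.
Qed.

(** The partial derivatives of [|q|^2] along [1] and [I] are [2 x] and [2 y].
    For [e = 1] the factor [x + e y I] is [q], for [e = -1] it is [conjq q]. *)
Lemma is_sderive_gauss e q :
  is_sderive e q gauss
    (- ((slice_x q)%:A + e *: (slice_y q *: slice_I q)) * gauss q).
Proof.
exists (- 2 * slice_x q * expR (- `|q| ^+ 2))%:A,
  (- 2 * slice_y q * expR (- `|q| ^+ 2))%:A; split.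
- rewrite (_ : slice_x q = dotq q 1); last by rewrite /dotq /slice_x /=; ring.
  exact: is_derive_algC (is_derive_gauss _ _).
- by rewrite -dotq_slice_I; exact: is_derive_algC (is_derive_gauss _ _).
rewrite /gauss -!scalerAr !mulr1.
case: (slice_I q) => a b c d.
by congr Quat; rewrite /=; field.
Qed.

Lemma is_sderive_gauss_dsbar q : ~ realq q ->
  is_sderive 1 q gauss (- (q * gauss q)).
Proof.
move=> qR; have := is_sderive_gauss 1 q.
by rewrite scale1r -(proj2 (sliceE qR)) mulNr.
Qed.

Lemma is_sderive_gauss_ds q : ~ realq q ->
  is_sderive (-1) q gauss (- (conjq q * gauss q)).
Proof.
move=> qR; have := is_sderive_gauss (-1) q.
rewrite scaleN1r (_ : _ - _ = conjq q) ?mulNr //.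
have -> : slice_y q *: slice_I q = q - (slice_x q)%:A.
  by rewrite [X in _ = X - _](proj2 (sliceE qR)) addrC addKr.
by rewrite conjqE mulr_natl mulr2n scalerDl opprB addrA.
Qed.

End Weights.

(** * Quaternionic Hermite polynomials *)

Section Hermite.
Context {R : realType}.
Implicit Types (q I p : quat R) (u : quat R -> quat R) (m n : nat).

Definition hcoef m n k : R := (-1) ^+ k * (k`! * 'C(m, k) * 'C(n, k))%:R.

(** The terms with [minn m n < k <= n] vanish; a range that does not
    involve [m] makes sums for different [m] comparable. *)
Lemma HQE m n q : HQ m n q =
  \sum_(k < n.+1) hcoef m n k *: (q ^+ (m - k) * conjq q ^+ (n - k)).
Proof.
rewrite /HQ -!(big_mkord xpredT (fun k => hcoef m n k *:
  (q ^+ (m - k) * conjq q ^+ (n - k)))).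
rewrite [RHS](big_cat_nat (n := (minn m n).+1)) //=; last first.
  by rewrite ltnS geq_minr.
rewrite [X in _ = _ + X]big_nat_cond [X in _ = _ + X]big1 ?addr0 // => k.
rewrite andbT => /andP[]; rewrite gtn_min ltnS => /orP[mk kn|nk kn].
  by rewrite /hcoef (bin_small mk) muln0 mul0n mulr0 scale0r.
by rewrite /hcoef (bin_small nk) muln0 mulr0 scale0r.
Qed.

Lemma HQ0 n q : HQ 0 n q = conjq q ^+ n.
Proof.
by rewrite /HQ min0n big_ord1 /= !bin0 !subn0 !expr0 !mul1r scale1r.
Qed.

(** The slice derivative [dsbar] of [HQ m n]: termwise, only the powers of
    [conjq q] are differentiated. *)
Definition HQ_dsbar m n q : quat R :=
  \sum_(k < n.+1) hcoef m n k *: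
    (q ^+ (m - k) * ((n - k)%:R *: conjq q ^+ (n - k).-1)).

(** Pascal's rule for ['C(m, k)] leaves in [q H_{m,n} - H_{m+1,n}] only the
    coefficients ['C(m, k - 1)]; after a shift of [k] these match thanks to
    [k.+1 * 'C(n, k.+1) = (n - k) * 'C(n, k)]. *)
Lemma HQ_rec m n q : HQ_dsbar m n q = q * HQ m n q - HQ m.+1 n q.
Proof.
rewrite !HQE mulr_sumr -sumrB.
(* the last term on the left has the factor [n - n], the first one on the
   right has coefficient [1 - 1] *)
rewrite [LHS]big_ord_recr /= subnn scale0r mulr0 scaler0 addr0.
rewrite [RHS]big_ord_recl.
rewrite /hcoef !bin0 !subn0 -scalerAr mulrA -exprS subrr add0r.
apply: eq_bigr => k _; rewrite -/(hcoef _ _ _) lift0 subSS.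
(* when [k >= m] the truncated exponent [m - k.+1] is wrong, but the
   coefficient is then 0 *)
have e1 : q * (hcoef m n k.+1 *: (q ^+ (m - k.+1) * conjq q ^+ (n - k.+1))) =
    hcoef m n k.+1 *: (q ^+ (m - k) * conjq q ^+ (n - k.+1)).
  rewrite -scalerAr mulrA -exprS.
  have [km|mk] := ltnP k m; first by rewrite -subSn.
  by rewrite /hcoef (bin_small (mk : (m < k.+1)%N)) muln0 mul0n mulr0 !scale0r.
rewrite -/(hcoef m n k.+1) -/(hcoef m.+1 n k.+1) e1 -scalerBl -scalerAr scalerA.
rewrite -subnS; congr (_ *: _).
rewrite /hcoef binS exprS -[_ * (n - k)%:R]mulrA -natrM.
have -> : (k`! * 'C(m, k) * 'C(n, k) * (n - k) =
  k.+1`! * 'C(m, k) * 'C(n, k.+1))%N.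
  by rewrite -mulnA [('C(n, k) * _)%N]mulnC -mul_bin_left factS; ring.
by rewrite !natrM natrD; ring.
Qed.

Lemma is_sderive_HQ m n q : ~ realq q ->
  is_sderive 1 q (fun z => HQ m n z) (q * HQ m n q - HQ m.+1 n q).
Proof.
move=> qR; have qI : half_slice (slice_I q) q by [].
have /commr_sym Iq := comm_slice_I qI.
have Iq' : GRing.comm (conjq q) (slice_I q).
  by apply: commr_sym; apply: comm_conjq; apply: commr_sym.
rewrite -HQ_rec; under eq_fun do rewrite HQE.
apply: is_sderive_sum => k; apply: is_sderiveZ.
have -> : q ^+ (m - k) * ((n - k)%:R *: conjq q ^+ (n - k).-1) =
    (((m - k)%:R * 0) *: q ^+ (m - k).-1) * conjq q ^+ (n - k) +
    q ^+ (m - k) * (((n - k)%:R * 1) *: conjq q ^+ (n - k).-1).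
  by rewrite mulr0 scale0r mul0r add0r mulr1.
apply: is_sderiveM; first by apply: commr_sym; apply: commrX; apply: commr_sym.
  apply: is_sderiveX => //.
  by have := is_sderive_id 1 qR; rewrite subrr mulr0.
apply: (is_sderiveX (w := @conjq R)) => //.
by have := is_sderive_conjq 1 qR; rewrite -[1 + 1]/2 mulVf ?pnatr_eq0.
Qed.

(** The sign makes these weights successive derivatives of each other: the
    Rodrigues formula for [HQ]. *)
Definition rodrigues_weight n m q : quat R := (-1) ^+ m *: (HQ m n q * gauss q).

Lemma is_sderive_rodrigues n m q : ~ realq q ->
  is_sderive 1 q (rodrigues_weight n m) (rodrigues_weight n m.+1 q).
Proof.
move=> qR; have qI : half_slice (slice_I q) q by [].
have H := is_sderiveM _ (is_sderive_HQ m n qR) (is_sderive_gauss_dsbar qR).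
have -> : rodrigues_weight n m.+1 q = (-1) ^+ m *:
    ((q * HQ m n q - HQ m.+1 n q) * gauss q + HQ m n q * - (q * gauss q)).
  rewrite mulrN mulrA -(comm_HQ m n (erefl : GRing.comm q q)) -mulrBl.
  rewrite addrAC subrr add0r mulNr scalerN -scaleNr /rodrigues_weight.
  by rewrite exprS mulN1r.
apply: is_sderiveZ; apply: H.
by apply: commr_sym; apply: comm_HQ; exact: comm_slice_I.
Qed.

(** The analogue of the previous weights for [ds], which kills [conjq] and
    multiplies the Gaussian by [- conjq q]. *)
Definition conj_weight i q : quat R := (-1) ^+ i *: (conjq q ^+ i * gauss q).

Lemma is_sderive_conj_weight i q : ~ realq q ->
  is_sderive (-1) q (conj_weight i) (conj_weight i.+1 q).
Proof.
move=> qR; have qI : half_slice (slice_I q) q by [].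
have Iq' : GRing.comm (conjq q) (slice_I q).
  by apply: commr_sym; apply: comm_conjq; exact: comm_slice_I.
have -> : conj_weight i.+1 q = (-1) ^+ i *:
    (((i%:R * 0) *: conjq q ^+ i.-1) * gauss q +
      conjq q ^+ i * - (conjq q * gauss q)).
  rewrite mulr0 scale0r mul0r add0r mulrN mulrA -exprSr scalerN -scaleNr.
  by rewrite /conj_weight exprS mulN1r.
apply: is_sderiveZ; apply: is_sderiveM.
- by apply: commr_sym; apply: commrX; exact: commr_sym.
- apply: (is_sderiveX (w := @conjq R)) => //.
  by have := is_sderive_conjq (-1) qR; rewrite subrr mulr0.
exact: is_sderive_gauss_ds.
Qed.

Lemma comm_gauss q p : GRing.comm p (gauss q).
Proof. exact: comm_algC. Qed.

Lemma comm_weight I q p (c : R) : GRing.comm I p ->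
  GRing.comm (c *: (p * gauss q)) I.
Proof.
move=> Ip; apply: commr_sym; rewrite /GRing.comm -scalerAr -scalerAl.
by congr (_ *: _); apply: commrM => //; exact: comm_gauss.
Qed.

Lemma gaussZ q p : expR (- `|q| ^+ 2) *: p = gauss q * p.
Proof. by rewrite -scalerAl mul1r. Qed.

Lemma expR_gauss q (c : R) p :
  (c * expR (`|q| ^+ 2)) *: (gauss q * p) = c *: p.
Proof. by rewrite -gaussZ scalerA -mulrA expRxMexpNx_1 mulr1. Qed.

(** A finite family of exponents [nu k] is allowed because the inner
    derivatives of [opB] produce one term for each power of [conjq q]. *)
Lemma iter_dsbar_rodrigues I m N (nu : 'I_N -> nat) (c : 'I_N -> R)
    (g : 'I_N -> quat R -> quat R) u :
  (forall k, slice_classC I m (g k)) ->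
  {in half_slice I, forall q,
    u q = \sum_(k < N) c k *: (conjq q ^+ nu k * gauss q * g k q)} ->
  {in half_slice I, forall q, iter m (@dsbar R) u q =
    gauss q * \sum_(k < N) \sum_(j < m.+1)
      (c k * ((-1) ^+ (m - j) * 'C(m, j)%:R)) *:
        (HQ (m - j) (nu k) q * iter j (@dsbar R) (g k) q)}.
Proof.
move=> Cg ug q qI; rewrite dsbarE.
rewrite (@iter_cr_leibniz _ 1 I m N
  (fun k i z => c k *: rodrigues_weight (nu k) i z) g) //.
- rewrite mulr_sumr; apply: eq_bigr => k _; rewrite mulr_sumr.
  apply: eq_bigr => j _; rewrite -scaler_nat /rodrigues_weight.
  rewrite (comm_gauss q (HQ (m - j) (nu k) q)) -!scalerAl -scalerAr !scalerA.
  by congr (_ *: _); [ring | rewrite mulrA].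
- move=> k i z zI; rewrite /rodrigues_weight scalerA; apply: comm_weight.
  by apply: comm_HQ; exact: comm_slice_I.
- by move=> k i z [zR _]; apply: is_sderiveZ; exact: is_sderive_rodrigues.
move=> z /ug ->; apply: eq_bigr => k _.
by rewrite /rodrigues_weight HQ0 scale1r scalerAl.
Qed.

Lemma iter_ds_gauss I n u :
  slice_classC I n u ->
  {in half_slice I, forall q,
    iter n (@ds R) (fun p => expR (- `|p| ^+ 2) *: u p) q =
    \sum_(k < n.+1) ((-1) ^+ (n - k) * 'C(n, k)%:R) *:
      (conjq q ^+ (n - k) * gauss q * iter k (@ds R) u q)}.
Proof.
move=> Cu q qI; rewrite dsE.
rewrite (@iter_cr_leibniz _ (-1) I n 1 (fun=> conj_weight) (fun=> u)) //.
- rewrite big_ord1; apply: eq_bigr => k _; rewrite -scaler_nat /conj_weight.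
  by rewrite -scalerAl scalerA mulrC.
- move=> _ i z zI; apply: comm_weight.
  by apply: commrX; apply: comm_conjq; exact: comm_slice_I.
- by move=> _ i z [zR _]; exact: is_sderive_conj_weight.
by move=> z _; rewrite big_ord1 /conj_weight scale1r mul1r gaussZ.
Qed.

(** The signs combine as [m + (m - j)] and [j] have the same parity. *)
Lemma hermite_coef m j : (j <= m)%N ->
  (-1) ^+ m * ((-1) ^+ (m - j) * 'C(m, j)%:R) =
  m`!%:R * ((-1) ^+ j / j`!%:R * (m - j)`!%:R^-1) :> R.
Proof.
move=> jm; rewrite -(bin_fact jm) !natrM -{1}(subnKC jm) exprD.
have F k : k`!%:R != 0 :> R by rewrite pnatr_eq0 -lt0n fact_gt0.
have S k : (-1) ^+ k * (-1) ^+ k = 1 :> R by rewrite -expr2 sqrr_sign.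
rewrite -mulrA [X in _ * X]mulrA S mul1r.
by field; rewrite !F.
Qed.

End Hermite.

(** * The expansions of [opA] and [opB] *)

Theorem theorem3p9 (R : realType) (m n : nat) (hm : (0 < m)%N) (hn : (0 < n)%N)
    (f : quat R -> quat R) (hf : classC (m + n) f) :
  (forall q : quat R, ~ realq q ->
     opA m n f q =
       ((m`! * n`!)%:R : R) *: \sum_(j < m.+1)
         ((-1) ^+ j / (j`!)%:R : R) *:
           (((((m - j)`! * n`!)%:R)^-1 *: HQ (m - j) n q)
              * iter j (@dsbar R) f q))
  /\
  (forall q : quat R, ~ realq q ->
     opB m n f q =
       ((m`! * n`!)%:R : R) *: \sum_(j < m.+1) \sum_(k < n.+1)
         ((-1) ^+ (j + k) / (j`! * k`!)%:R : R) *: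
           (((((m - j)`! * (n - k)`!)%:R)^-1 *: HQ (m - j) (n - k) q)
              * iter j (@dsbar R) (iter k (@ds R) f) q)).
Proof.
have F k : k`!%:R != 0 :> R by rewrite pnatr_eq0 -lt0n fact_gt0.
split=> q qR.
(* a single product, with the constant exponent [n] *)
- have qI : q \in half_slice (slice_I q) by rewrite inE.
  rewrite /opA (@iter_dsbar_rodrigues _ (slice_I q) m 1 (fun=> n)
    (fun=> 1) (fun=> f)) //; last 2 first.
  + by move=> _; apply: (@slice_classC_addl _ m n); rewrite addnC; exists f.
  + by move=> z _; rewrite big_ord1 scale1r gaussZ mulrA.
  rewrite expR_gauss big_ord1 !scaler_sumr; apply: eq_bigr => j _.
  rewrite mul1r -scalerAl !scalerA; congr (_ *: _).
  rewrite hermite_coef ?natrM; last by rewrite -ltnS.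
  by field; rewrite !F.
(* the [n + 1] products left by the inner derivatives *)
have qI : q \in half_slice (slice_I q) by rewrite inE.
rewrite /opB (@iter_dsbar_rodrigues _ (slice_I q) m n.+1 (fun k => n - k)%N
  (fun k => (-1) ^+ (n - k) * 'C(n, k)%:R) (fun k => iter k (@ds R) f)) //;
  last 2 first.
- move=> k; rewrite dsE; apply: slice_classC_iter.
  apply: (@slice_classC_addl _ _ (n - k)); rewrite addnA subnK -1?ltnS //.
  by rewrite addnC; exists f.
- by apply: iter_ds_gauss; apply: (@slice_classC_addl _ n m); exists f.
rewrite expR_gauss exchange_big !scaler_sumr; apply: eq_bigr => j _.
rewrite !scaler_sumr; apply: eq_bigr => k _.
rewrite -[X in _ = _ *: (_ *: X)]scalerAl !scalerA; congr (_ *: _).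
have jm : (j <= m)%N by rewrite -ltnS.
have kn : (k <= n)%N by rewrite -ltnS.
transitivity ((-1) ^+ m * ((-1) ^+ (m - j) * 'C(m, j)%:R) *
    ((-1) ^+ n * ((-1) ^+ (n - k) * 'C(n, k)%:R)) : R).
  by rewrite exprD; ring.
rewrite !hermite_coef // [(-1) ^+ (j + k)]exprD !natrM.
by field; rewrite !F.
Qed.
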